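(* Let $\kappa \le \mathfrak{c}$ be a cardinal of uncountable cofinality. Then there is a family $\{X_\alpha : \alpha < \mathfrak{c}\}$ of pairwise distinct subsets of $2^\omega$, each of size $\kappa$, which are pairwise homeomorphic (as subspaces of $2^\omega$), such that the spaces $\Psi(\mathcal{A}_{X_\alpha})$, $\alpha < \mathfrak{c}$, are pairwise non-homeomorphic.
   Context: For $x \in 2^\omega$ let $\widehat{x} = \{x \restriction k : k \in \omega\} \subseteq 2^{<\omega}$, and for $X \subseteq 2^\omega$ let $\mathcal{A}_X = \{\widehat{x} : x \in X\}$; this is an almost disjoint family on the countable set $2^{<\omega}$ (a family of infinite subsets any two distinct members of which have finite intersection). For an almost disjoint family $\mathcal{A}$ on a countable set $N$, the space $\Psi(\mathcal{A})$ has underlying set $N \cup \mathcal{A}$; points of $N$ are isolated, and basic neighborhoods of a point $x \in \mathcal{A}$ are the sets $\{x\} \cup (x \setminus F)$ with $F \subseteq N$ finite. *)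

(* Defs.v *)
From HB Require Import structures.
From mathcomp Require Import all_boot all_order.
From mathcomp Require Import all_classical all_reals topology cantor.
Set Implicit Arguments. Unset Strict Implicit. Unset Printing Implicit Defensive.
Local Open Scope classical_set_scope.
Local Open Scope card_scope.

(* The cardinal kappa is represented by a type K (kappa = |K|).
   "kappa has uncountable cofinality" : kappa is infinite and is not the union
   of countably many subsets each of cardinality < kappa.  For infinite
   cardinals this is the (choice-)standard characterization cf(kappa) > omega. *)
Definition uncountable_cofinality (K : Type) : Prop :=
  infinite_set [set: K] /\
  forall A : nat -> set K,
    (forall n, ~ ([set: K] #<= A n)) -> \bigcup_n A n <> [set: K].

Definition restr (x : cantor_space) (k : nat) : seq bool := mkseq x k.

Definition subspace_homeomorphic (X Y : set cantor_space) : Prop :=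
  exists f g : cantor_space -> cantor_space,
    (forall x, X x -> Y (f x)) /\ (forall y, Y y -> X (g y)) /\
    (forall x, X x -> g (f x) = x) /\ (forall y, Y y -> f (g y) = y) /\
    {within X, continuous f} /\ {within Y, continuous g}.

(* Points of Psi(A_X): inl s for s in N = 2^{<omega}, inr x standing for the
   element hat(x) of A_X (x |-> hat(x) is injective). *)
Definition psi_pt := (seq bool + cantor_space)%type.

Definition psi_points (X : set cantor_space) : set psi_pt :=
  fun p => match p with inl _ => True | inr x => X x end.

(* open sets of Psi(A_X): every point hat(x) of U has a basic neighbourhood
   {hat x} u (hat x \ F), F finite subset of N, contained in U. *)
Definition psi_open (X : set cantor_space) (U : set psi_pt) : Prop :=
  U `<=` psi_points X /\
  forall x, U (inr x) ->
    exists F : seq (seq bool), forall k, restr x k \notin F -> U (inl (restr x k)).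

Definition psi_homeomorphic (X Y : set cantor_space) : Prop :=
  exists h g : psi_pt -> psi_pt,
    (forall p, psi_points X p -> psi_points Y (h p)) /\
    (forall q, psi_points Y q -> psi_points X (g q)) /\
    (forall p, psi_points X p -> g (h p) = p) /\
    (forall q, psi_points Y q -> h (g q) = q) /\
    (forall V, psi_open Y V -> psi_open X (psi_points X `&` h @^-1` V)) /\
    (forall U, psi_open X U -> psi_open Y (psi_points Y `&` g @^-1` U)).

(* Main.v *)
Require Import Defs.
From mathcomp Require Import all_boot all_order.
From mathcomp Require Import all_classical all_reals topology cantor.
From mathcomp Require Import zify.
Local Open Scope classical_set_scope.
Local Open Scope card_scope.

(** A homeomorphism of Psi(A_X) onto Psi(A_Y) restricts to a permutation of
    2^{<omega} and maps each branch of X, up to finitely many nodes, onto a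
    branch of Y.  Sorting the points of X by the number n of exceptional nodes
    writes X as a countable union of pieces on which the induced bijection moves
    the splitting level of two points by at most n.  Hence, if the splitting
    levels of X and those of Y drift apart, i.e. for each n only finitely many
    pairs of levels are at distance at most n, then each piece is finite and X is
    countable.

    So it suffices to spread one fixed set of size kappa along sparse sets of
    coordinates: the bit x k is moved to position 2 ^ (code of a|k), for each
    index a.  Different indices share finitely many a|k, and distinct powers
    of 2 are far apart. *)

(** * Branches and their initial segments *)

Lemma restrP (x y : cantor_space) m :
  restr x m = restr y m <-> forall i, i < m -> x i = y i.
Proof.
split=> [xy i im|xy].
  by rewrite -(nth_mkseq false x im) -(nth_mkseq false y im) -/(restr x m) xy.
apply: (@eq_from_nth _ false); rewrite !size_mkseq // => i im.
by rewrite !nth_mkseq // xy.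
Qed.

Lemma restr_inj (x : cantor_space) : injective (restr x).
Proof. by move=> k l /(congr1 size); rewrite !size_mkseq. Qed.

Lemma first_difference (x y : cantor_space) :
  x <> y -> exists2 m, restr x m = restr y m & x m <> y m.
Proof.
move=> xy; have ex : exists m, x m != y m.
  apply: contrapT => nex; apply: xy; apply/funext => m.
  by apply/eqP; apply: contrapT => /negP ?; apply: nex; exists m.
case: (ex_minnP ex) => m /eqP xym m_min; exists m => //.
apply/restrP => i im; apply/eqP; apply: contraTT im => /m_min.
by rewrite -leqNgt.
Qed.

Lemma cofinite_restr (x : cantor_space) (F : seq (seq bool)) :
  exists n, forall k, n <= k -> restr x k \notin F.
Proof.
exists (\max_(s <- F) size s).+1 => k nk; apply/negP => kF.
have := @leq_bigmax_seq _ F xpredT size _ kF isT.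
by rewrite size_mkseq leqNgt nk.
Qed.

(** * Action of a homeomorphism on nodes and branches *)

(** The body of [psi_homeomorphic] with its witnesses exposed, so that every fact about [h] can be
    applied to [g] as well. *)
Definition psi_iso (X Y : set cantor_space) (h g : psi_pt -> psi_pt) : Prop :=
  (forall p, psi_points X p -> psi_points Y (h p)) /\
  (forall q, psi_points Y q -> psi_points X (g q)) /\
  (forall p, psi_points X p -> g (h p) = p) /\
  (forall q, psi_points Y q -> h (g q) = q) /\
  (forall V, psi_open Y V -> psi_open X (psi_points X `&` h @^-1` V)) /\
  (forall U, psi_open X U -> psi_open Y (psi_points Y `&` g @^-1` U)).

Lemma psi_iso_sym {X Y h g} : psi_iso X Y h g -> psi_iso Y X g h.
Proof. by case=> hXY [gYX [hK [gK [hc gc]]]]. Qed.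

(** The singleton of a node is open, whereas an open set containing a branch also contains nodes of
    it. *)
Lemma psi_iso_inl {X Y h g} : psi_iso X Y h g ->
  forall s, exists t, h (inl s) = inl t.
Proof.
move=> [hXY [gYX [hK [gK [_ gc]]]]] s.
have /gc[_ op] : psi_open X [set inl s] by split=> [p ->|x /=].
case E: (h (inl s)) => [t|y]; first by exists t.
have Yy : Y y by have := hXY (inl s) I; rewrite E.
have [|F FP] := op y; first by split=> //=; rewrite -E hK.
have [n nF] := cofinite_restr y F.
have /FP[_ /= gn] := nF n (leqnn n).
by have := gK (inl (restr y n)) I; rewrite gn E.
Qed.

Lemma psi_iso_inr {X Y h g} : psi_iso X Y h g ->
  forall x, X x -> exists2 y, Y y & h (inr x) = inr y.
Proof.
move=> hg x Xx; case: (hg) => hXY [_ [hK _]].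
case E: (h (inr x)) => [t|y].
  have [s gt] := psi_iso_inl (psi_iso_sym hg) t.
  by have := hK (inr x) Xx; rewrite E gt.
by exists y => //; have := hXY (inr x) Xx; rewrite E.
Qed.

Definition maps_tail (h : psi_pt -> psi_pt) (n : nat) (x y : cantor_space) : Prop :=
  forall k, n <= k -> exists j, h (inl (restr x k)) = inl (restr y j).

Lemma maps_tailW {h n n' x y} : n <= n' -> maps_tail h n x y -> maps_tail h n' x y.
Proof. by move=> nn' hn k /(leq_trans nn')/hn. Qed.

Lemma psi_iso_tail {X Y h g x y} : psi_iso X Y h g ->
  X x -> h (inr x) = inr y -> exists n, maps_tail h n x y.
Proof.
move=> hg Xx hx; case: (hg) => hXY [_ [_ [_ [hc _]]]].
have Yy : Y y by have := hXY (inr x) Xx; rewrite hx.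
(* The largest basic neighbourhood of [y]: the branch with all its nodes. *)
pose V : set psi_pt :=
  fun p => match p with inl s => exists j, s = restr y j | inr z => z = y end.
have /hc[_ op] : psi_open Y V.
  split=> [[//|z -> //]|z /= ->]; by exists [::] => k _; exists k.
have [|F FP] := op x; first by split=> //=; rewrite hx.
have [n nF] := cofinite_restr x F; exists n => k nk.
have /FP[_ /=] := nF k nk.
by have [t ->] := psi_iso_inl hg (restr x k) => -[j ->]; exists j.
Qed.

(* The nodes x|k with n <= k <= m are sent to m - n + 1 distinct nodes common to
   the branches y and y', so one of these has length at least m - n. *)
Lemma maps_tail_lipschitz {X Y h g n m x x' y y'} : psi_iso X Y h g ->
  maps_tail h n x y -> maps_tail h n x' y' ->
  restr x m = restr x' m -> restr y (m - n) = restr y' (m - n).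
Proof.
move=> [_ [_ [hK _]]] xy xy' /restrP xx'.
have [f hf] := choice (fun i => xy (n + i) (leq_addr i n)).
have finj : injective f.
  move=> i j fij; have := hf i; rewrite fij -hf => /(congr1 g).
  by rewrite !hK // => -[/restr_inj]; lia.
(* Pigeonhole; [maxn] covers the case [m <= n], where [m - n] is 0 and [i = 0] works. *)
have [i [im mfi]] : exists i, n + i <= maxn n m /\ m - n <= f i.
  apply: contrapT => nex.
  have fsmall (i : 'I_(m - n).+1) : f i < m - n.
    rewrite ltnNge; apply/negP => fi; apply: nex; exists i; split => //.
    by have := ltn_ord i; lia.
  have := @leq_card _ _ (fun i => Ordinal (fsmall i)).
  rewrite !card_ord ltnn => /(_ _)/negP; apply=> // i j [/finj ij].
  exact: val_inj.
have [|lt_nm] := leqP m n; first by rewrite -subn_eq0 => /eqP->.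
have E : restr x (n + i) = restr x' (n + i).
  by apply/restrP => l ?; apply: xx'; lia.
have [|j] := xy' (n + i); first by lia.
rewrite -E hf => -[yy'].
have fj : f i = j by move/(congr1 size): yy'; rewrite !size_mkseq.
rewrite -fj in yy'; apply/restrP => l ?.
by move/restrP: yy'; apply; lia.
Qed.

(** * Drifting splitting levels force countability *)

Lemma psi_homeomorphic_countable (X Y : set cantor_space) (S T : set nat) :
  (forall x x' i, X x -> X x' -> x i <> x' i -> S i) ->
  (forall y y' i, Y y -> Y y' -> y i <> y' i -> T i) ->
  (forall n, exists M, forall s t,
     S s -> T t -> s <= t + n -> t <= s + n -> s <= M) ->
  psi_homeomorphic X Y -> countable X.
Proof.
move=> XS YT ST [h [g hg]]; have gh := psi_iso_sym hg.
(* Both directions matter: the tail condition on [h] keeps the splitting level from dropping by more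
   than [n], the one on [g] from rising by more than [n]. *)
pose P n := [set x | X x /\ exists y, [/\ Y y, h (inr x) = inr y,
                                       maps_tail h n x y & maps_tail g n y x]].
have XP : X `<=` \bigcup_n P n.
  move=> x Xx; have [y Yy hx] := psi_iso_inr hg x Xx.
  have gy : g (inr y) = inr x by rewrite -hx; case: hg => _ [_ [-> //]].
  have [n1 t1] := psi_iso_tail hg Xx hx.
  have [n2 t2] := psi_iso_tail gh Yy gy.
  exists (maxn n1 n2) => //; split => //; exists y; split => //.
    exact: maps_tailW (leq_maxl _ _) t1.
  exact: maps_tailW (leq_maxr _ _) t2.
apply: sub_countable (subset_card_le XP) _; apply: bigcup_countable => // n _.
have [M MP] := ST n.
(* Distinct points of [P n] split at a level at most [M], so [M.+1] bits tell them apart. *)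
apply/countable_injP; exists (fun x => pickle (restr x M.+1)).
move=> x x' /[!inE] -[Xx [y [Yy hx xy yx]]] [Xx' [y' [Yy' hx' xy' yx']]].
move=> /(pcan_inj pickleK) /restrP xx'; apply: contrapT => neq.
have [m em dm] := first_difference _ _ neq.
have neq' : y <> y'.
  move=> yy'; apply: neq; have := hx; rewrite yy' -hx' => /(congr1 g).
  by case: hg => _ [_ [hK _]]; rewrite !hK // => -[].
have [p ep dp] := first_difference _ _ neq'.
have mp : m - n <= p.
  rewrite leqNgt; apply/negP => pm; apply: dp.
  by move/restrP: (maps_tail_lipschitz hg xy xy' em); apply.
have pm : p - n <= m.
  rewrite leqNgt; apply/negP => mp'; apply: dm.
  by move/restrP: (maps_tail_lipschitz gh yx yx' ep); apply.
have mM : m <= M.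
  by apply: (MP m p); [exact: (XS x x')|exact: (YT y y')|lia|lia].
exact/dm/xx'.
Qed.

(** * Spreading a set along sparse coordinates *)

Definition level (a : cantor_space) (k : nat) : nat := 2 ^ pickle (restr a k).

Definition spread (a x : cantor_space) : cantor_space :=
  fun i => `[< exists k, i = level a k /\ x k >].

Definition unspread (a y : cantor_space) : cantor_space := fun k => y (level a k).

Lemma level_inj a : injective (level a).
Proof. by move=> k l /(expnI (leqnn 2))/(pcan_inj pickleK)/restr_inj. Qed.

Lemma spread_level a x k : spread a x (level a k) = x k.
Proof.
rewrite /spread; apply/asboolP/idP => [[l [/level_inj -> //]]|xk].
by exists k.
Qed.

Lemma spread_notin a x i : ~ range (level a) i -> spread a x i = false.
Proof. by move=> ni; apply/asboolP => -[k [ik _]]; apply: ni; exists k. Qed.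

Lemma spreadK a : cancel (spread a) (unspread a).
Proof. by move=> x; apply/funext => k; exact: spread_level. Qed.

Lemma level_drift a b : a <> b -> forall n, exists M, forall s t,
  range (level a) s -> range (level b) t -> s <= t + n -> t <= s + n -> s <= M.
Proof.
move=> /first_difference[m _ abm] n.
(* Equal codes mean a common initial segment of [a] and [b], of length at most [m]: first bound. For
   distinct codes the larger power is at least twice the smaller, so a gap of at most [n] keeps both
   below [2 * n]. *)
exists (maxn (\max_(k < m.+1) level a k) (2 * n)).
move=> _ _ [k _ <-] [l _ <-]; rewrite leq_max.
have expn_gap u v : u < v -> 2 * 2 ^ u <= 2 ^ v by rewrite -expnS leq_exp2l.
rewrite /level.
case: (ltngtP (pickle (restr a k)) (pickle (restr b l))).
- by move/expn_gap; lia.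
- by move/expn_gap; lia.
move=> /(pcan_inj pickleK) kl _ _.
have kl' : k = l by move/(congr1 size): kl; rewrite !size_mkseq.
have km : k < m.+1.
  rewrite ltnNge; apply/negP => mk; apply: abm.
  by rewrite -kl' in kl; move/restrP: kl; apply.
by rewrite (@leq_bigmax _ (fun i : 'I_m.+1 => 2 ^ pickle (restr a i)) (Ordinal km)).
Qed.

Lemma coordinatewise_continuous (f : cantor_space -> cantor_space) :
  (forall i, (exists j, forall x, f x i = x j) \/
             (exists b, forall x, f x i = b)) ->
  continuous f.
Proof.
move=> fP x; apply/cvg_sup => i.
move: x; apply/(@continuousP _ (initial_topology (@^~ i))) => A [B oB <-].
case: (fP i) => [[j fj]|[b fb]].
  rewrite (_ : _ @^-1` _ = proj j @^-1` B); last first.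
    by apply/seteqP; split=> x; rewrite /preimage /= /proj fj.
  by apply: open_comp => // + _; exact: proj_continuous.
rewrite (_ : _ @^-1` _ = (fun=> b) @^-1` B); last first.
  by apply/seteqP; split=> x; rewrite /preimage /= fb.
by apply: open_comp => // + _; exact: cst_continuous.
Qed.

(** Each output bit is either a fixed input bit or constantly false. *)
Lemma respread_continuous a b : continuous (spread b \o unspread a).
Proof.
apply: coordinatewise_continuous => i.
have [[k _ <-]|ni] := pselect (range (level b) i).
  by left; exists (level a k) => x /=; rewrite spread_level.
by right; exists false => x /=; rewrite spread_notin.
Qed.

Lemma subspace_homeomorphic_spread (Z : set cantor_space) a b :
  subspace_homeomorphic (spread a @` Z) (spread b @` Z).
Proof.
exists (spread b \o unspread a), (spread a \o unspread b); split; last split.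
- by move=> _ [x Zx <-]; exists x => //=; rewrite spreadK.
- by move=> _ [x Zx <-]; exists x => //=; rewrite spreadK.
split; last split.
- by move=> _ [x Zx <-] /=; rewrite !spreadK.
- by move=> _ [x Zx <-] /=; rewrite !spreadK.
by split; apply: continuous_subspaceT; exact: respread_continuous.
Qed.

Lemma psi_homeomorphic_spread_countable (Z : set cantor_space) a b : a <> b ->
  psi_homeomorphic (spread a @` Z) (spread b @` Z) -> countable (spread a @` Z).
Proof.
move=> ab; apply: (@psi_homeomorphic_countable _ _ (range (level a)) (range (level b))).
- move=> _ _ i [x _ <-] [x' _ <-] neq; apply: contrapT => ni.
  by apply: neq; rewrite !spread_notin.
- move=> _ _ i [x _ <-] [x' _ <-] neq; apply: contrapT => ni.
  by apply: neq; rewrite !spread_notin.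
exact: level_drift.
Qed.

Lemma psi_homeomorphic_refl X : psi_homeomorphic X X.
Proof.
exists id, id; do 4?[split=> //]; split=> U [UX op];
  by rewrite preimage_id (setIidr UX); split.
Qed.

(** An injection into [nat] would split [K] into countably many fibres with at most one point
    each. *)
Lemma uncountable_cofinality_uncountable (K : Type) :
  uncountable_cofinality K -> ~ countable [set: K].
Proof.
move=> [Kinf Kcof] /countable_injP[f finj].
apply: (Kcof (fun n => f @^-1` [set n])) => [n Kn|]; last first.
  by apply/seteqP; split=> // x _; exists (f x).
apply: Kinf; apply: card_le_finite Kn _.
have [[x xn]|nex] := pselect (exists x, f x = n).
  apply: (@sub_finite_set _ _ [set x]) => // y /= yn.
  by apply: finj; rewrite ?inE // yn.
by apply: (@sub_finite_set _ _ set0) => // y /= yn; case: nex; exists y.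
Qed.

(* kappa = |K|; the index set {alpha < c} is represented by cantor_space (size c). *)
Theorem theorem14 (K : Type) :
  [set: K] #<= [set: cantor_space] ->
  uncountable_cofinality K ->
  exists X : cantor_space -> set cantor_space,
    [/\ (forall a b, a <> b -> X a <> X b),
        (forall a, X a #= [set: K]),
        (forall a b, subspace_homeomorphic (X a) (X b)) &
        (forall a b, a <> b -> ~ psi_homeomorphic (X a) (X b))].
Proof.
move=> /pcard_injP[f finj] /uncountable_cofinality_uncountable Kunc.
pose Z := range f.
have XK a : spread a @` Z #= [set: K].
  apply: card_eq_trans (inj_card_eq finj); apply: inj_card_eq => x y _ _.
  exact/can_inj/spreadK.
have nonhomeo a b : a <> b -> ~ psi_homeomorphic (spread a @` Z) (spread b @` Z).
  move=> ab /(psi_homeomorphic_spread_countable _ _ _ ab).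
  by rewrite (eq_countable (XK a)).
exists (fun a => spread a @` Z); split => //.
- by move=> a b /nonhomeo nab ab; apply: nab; rewrite ab; exact: psi_homeomorphic_refl.
- by move=> a b; exact: subspace_homeomorphic_spread.
Qed.
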